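(* Let $R$ be a Lie conformal algebra. Then: (1) $C(R)+CDer(R)\subseteq QDer(R)$. (2) $C(R)\subseteq QDer(R)\cap QC(R)$. (3) $GDer(R)=QDer(R)+QC(R)$.
   Context: Let $\mathcal{A}=\mathbb{C}[\partial]$. A Lie conformal algebra is an $\mathcal{A}$-module $R$ with a $\mathbb{C}$-bilinear map $R\otimes R\to R[\lambda]$, $a\otimes b\mapsto[a_\lambda b]$, such that for all $a,b,c\in R$: $[\partial a_\lambda b]=-\lambda[a_\lambda b]$, $[a_\lambda\partial b]=(\partial+\lambda)[a_\lambda b]$; $[a_\lambda b]=-[b_{-\lambda-\partial}a]$; $[a_\lambda[b_\mu c]]=[[a_\lambda b]_{\lambda+\mu}c]+[b_\mu[a_\lambda c]]$. $gc(R)=Cend(R)$ is the set of conformal linear maps from $R$ to $R$, i.e. $\mathbb{C}$-linear maps $D_\lambda:R\to R[\lambda]$ with $D_\lambda(\partial a)=(\partial+\lambda)D_\lambda(a)$ for all $a\in R$. Brackets such as $[(D_\lambda a)_{\lambda+\mu}b]$ are extended linearly over polynomials in the indeterminates. $CDer(R)$ (conformal derivations): $D_\lambda\in gc(R)$ with $D_\lambda([a_\mu b])=[(D_\lambda a)_{\lambda+\mu}b]+[a_\mu(D_\lambda b)]$ for all $a,b\in R$. $QDer(R)$ (conformal quasiderivations): $D_\lambda\in gc(R)$ for which there is $D'_\lambda\in gc(R)$ with $[(D_\lambda a)_{\lambda+\mu}b]+[a_\mu(D_\lambda b)]=D'_\lambda([a_\mu b])$ for all $a,b\in R$. $GDer(R)$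 (generalized conformal derivations): $D_\lambda\in gc(R)$ for which there are $D'_\lambda,D''_\lambda\in gc(R)$ with $[(D_\lambda a)_{\lambda+\mu}b]+[a_\mu(D'_\lambda b)]=D''_\lambda([a_\mu b])$ for all $a,b\in R$. $C(R)$ (conformal centroids): $D_\lambda\in gc(R)$ with $D_\lambda([a_\mu b])=[(D_\lambda a)_{\lambda+\mu}b]=[a_\mu(D_\lambda b)]$ for all $a,b\in R$. $QC(R)$ (conformal quasicentroids): $D_\lambda\in gc(R)$ with $[(D_\lambda a)_{\lambda+\mu}b]=[a_\mu(D_\lambda b)]$ for all $a,b\in R$. *)

(* Defs.v *)
From HB Require Import structures.
From mathcomp Require Import all_boot all_order all_algebra.
From mathcomp Require Import finmap.
From mathcomp Require Import classical_sets functions reals.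
From mathcomp Require Import complex.
From mathcomp Require Import monalg.

Set Implicit Arguments.
Unset Strict Implicit.
Unset Printing Implicit Defensive.

Import GRing.Theory.
Local Open Scope ring_scope.

(* For an A-module V, [lpoly V] is V[x], the polynomials in one central
   indeterminate with coefficients in V, as finitely supported families
   nat -> V.  It is a module over A[x] = {poly A}, so that iterating the
   construction yields V[x][y] as a module over A[x][y]. *)
Definition lpoly (A : comNzRingType) (V : lmodType A) : Type := {malg V[nat]}.

HB.instance Definition _ (A : comNzRingType) (V : lmodType A) :=
  GRing.Zmodule.copy (lpoly V) {malg V[nat]}.

Section LPoly.
Variables (A : comNzRingType) (V : lmodType A).
Implicit Types (p q : {poly A}) (u v : lpoly V).

Definition lpcoef u (n : nat) : V := mcoeff n u.
Definition lpmonom (n : nat) (x : V) : lpoly V := mkmalgU n x.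
Definition lpconst (x : V) : lpoly V := lpmonom 0 x.

Lemma lpolyP u v : (forall n, lpcoef u n = lpcoef v n) <-> u = v.
Proof. exact: malgP. Qed.

Lemma lpcoefD n u v : lpcoef (u + v) n = lpcoef u n + lpcoef v n.
Proof. exact: mcoeffD. Qed.

Lemma lpcoef0 n : lpcoef 0 n = 0.
Proof. exact: mcoeff0. Qed.

Lemma lpcoef_monom n x k : lpcoef (lpmonom n x) k = if k == n then x else 0.
Proof. by rewrite /lpcoef mcoeffU eq_sym; case: eqP; rewrite ?mulr1n. Qed.

Lemma lpcoef_sum (I : Type) (r : seq I) (P : pred I) (F : I -> lpoly V) n :
  lpcoef (\sum_(i <- r | P i) F i) n = \sum_(i <- r | P i) lpcoef (F i) n.
Proof. exact: (big_morph (lpcoef^~ n) (lpcoefD n) (lpcoef0 n)). Qed.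

(* (sum_i p_i x^i) (sum_k u_k x^k) = sum_(i, k) (p_i u_k) x^(i + k) *)
Definition lpscale p u : lpoly V :=
  \sum_(i < size p) \sum_(k <- msupp u) lpmonom (i + k) (p`_i *: lpcoef u k).

Lemma lpcoef_scale p u n :
  lpcoef (lpscale p u) n = \sum_(i < n.+1) p`_i *: lpcoef u (n - i).
Proof.
have inner (i : nat) : lpcoef (\sum_(k <- msupp u)
    lpmonom (i + k) (p`_i *: lpcoef u k)) n =
    if (i <= n)%N then p`_i *: lpcoef u (n - i) else 0.
  rewrite lpcoef_sum; case: leqP => [le_in|lt_ni]; last first.
    rewrite big1 // => k _; rewrite lpcoef_monom; case: eqP => // nE.
    by move: lt_ni; rewrite nE ltnNge leq_addr.
  have kE k : (n == i + k)%N = (k == n - i)%N.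
    by rewrite -{1}(subnKC le_in) eqn_add2l eq_sym.
  under eq_bigr do rewrite lpcoef_monom kE.
  have [ni_in|ni_out] := boolP ((n - i)%N \in msupp u).
    rewrite (bigD1_seq (n - i)%N) ?fset_uniq //= eqxx big1 ?addr0 // => k.
    by move/negPf->.
  rewrite big1_seq => [|k /= k_in].
    by rewrite /lpcoef (mcoeff_outdom ni_out) scaler0.
  by case: eqP k_in => // ->; rewrite (negPf ni_out).
rewrite lpcoef_sum; under eq_bigr do rewrite inner.
rewrite -(big_mkord xpredT
  (fun i => if (i <= n)%N then p`_i *: lpcoef u (n - i) else 0)).
rewrite -(big_mkord xpredT (fun i => p`_i *: lpcoef u (n - i))).
pose m := maxn (size p) n.+1.
rewrite (big_nat_widen _ _ m) ?leq_maxl //.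
rewrite [RHS](big_nat_widen _ _ m) ?leq_maxr //.
rewrite big_mkcond [RHS]big_mkcond /=; apply: eq_bigr => i _.
rewrite ltnS; case: (leqP (size p) i) => // le_pi.
by rewrite nth_default // scale0r; case: ifP.
Qed.

Lemma lpscaleA p q u : lpscale p (lpscale q u) = lpscale (p * q) u.
Proof.
apply/lpolyP => n; rewrite !lpcoef_scale.
pose c i j := (p`_i * q`_(j - i)) *: lpcoef u (n - j).
transitivity (\sum_(i < n.+1) \sum_(j < n.+1 | (i <= j)%N) c i j); last first.
  rewrite (exchange_big_dep xpredT) //=; apply: eq_bigr => j _.
  rewrite coefM scaler_suml.
  rewrite -(big_mkord xpredT (fun i => c i j)).
  rewrite -(big_mkord (leq^~ j) (fun i => c i j)).
  by rewrite [RHS](big_nat_widen _ _ n.+1).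
apply: eq_bigr => i _; rewrite lpcoef_scale scaler_sumr.
have le_in : (i <= n)%N by rewrite -ltnS.
rewrite -(big_mkord (fun j => i <= j)%N (c i)).
have lo0 : \sum_(0 <= j < i | (i <= j)%N) c i j = 0.
  by rewrite big_nat_cond big1 // => j /andP[/andP[_ ji]]; rewrite leqNgt ji.
rewrite (big_cat_nat (n := i)) //=; last by rewrite ltnW.
rewrite lo0 add0r.
rewrite -[X in index_iota X _]add0n big_addn big_mkord subSn //.
apply: eq_big => [j|j _]; first by rewrite leq_addl.
by rewrite /c addnK scalerA subnDA subnAC.
Qed.

Lemma lpscale1 : left_id 1 lpscale.
Proof.
move=> u; apply/lpolyP => n; rewrite lpcoef_scale big_ord_recl big1 => [|i _].
  by rewrite coef1 scale1r addr0 subn0.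
by rewrite coef1 scale0r.
Qed.

Lemma lpscaleDr : right_distributive lpscale +%R.
Proof.
move=> p u v; apply/lpolyP => n; rewrite lpcoefD !lpcoef_scale -big_split /=.
by apply: eq_bigr => i _; rewrite lpcoefD scalerDr.
Qed.

Lemma lpscaleDl u : {morph lpscale^~ u : p q / p + q}.
Proof.
move=> p q; apply/lpolyP => n; rewrite lpcoefD !lpcoef_scale -big_split /=.
by apply: eq_bigr => i _; rewrite coefD scalerDl.
Qed.

HB.instance Definition _ := GRing.Zmodule_isLmodule.Build {poly A} (lpoly V)
  lpscaleA lpscale1 lpscaleDr lpscaleDl.

(* [lpsubst s f u] is sum_n s^n f(u_n): the extension of f to polynomials
   in an indeterminate which is replaced by s. *)
Definition lpsubst (B : comNzRingType) (W : lmodType B)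
    (s : B) (f : V -> W) (u : lpoly V) : W :=
  \sum_(n <- msupp u) s ^+ n *: f (lpcoef u n).

End LPoly.

Arguments lpconst {A V} x.

Section TwoVariables.
Variables (C : fieldType) (V : lmodType {poly C}).

(* V[mu][lambda] is [lpoly (lpoly V)], a module over C[d][mu][lambda]:
   lambda is the outermost indeterminate. *)
Definition lam2 : {poly {poly {poly C}}} := 'X.
Definition mu2 : {poly {poly {poly C}}} := 'X%:P.

Definition at2 (s : {poly {poly {poly C}}}) (u : lpoly V) : lpoly (lpoly V) :=
  lpsubst s (fun x => lpconst (lpconst x)) u.

End TwoVariables.

Arguments lam2 {C}.
Arguments mu2 {C}.

(* [lbr a b] is [a_lambda b] in V[lambda].  In {poly C} the indeterminate 'X
   is the derivation d; in {poly {poly C}}, which acts on V[lambda], 'X is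
   lambda and 'X%:P is d. *)
HB.mixin Record Lmodule_isLieConformal (C : fieldType) V
    of GRing.Lmodule {poly C} V := {
  lbr : V -> V -> lpoly V;
  lbrDl : forall a a' b, lbr (a + a') b = lbr a b + lbr a' b;
  lbrDr : forall a b b', lbr a (b + b') = lbr a b + lbr a b';
  lbrZl : forall (c : C) a b, lbr (c%:P *: a) b = c%:P%:P *: lbr a b;
  lbrZr : forall (c : C) a b, lbr a (c%:P *: b) = c%:P%:P *: lbr a b;
  lbr_dl : forall a b, lbr ('X *: a) b = - 'X *: lbr a b;
  lbr_dr : forall a b, lbr a ('X *: b) = ('X%:P + 'X) *: lbr a b;
  (* [a_lambda b] = - [b_(- lambda - d) a] *)
  lbr_skew : forall a b,
    lbr a b = - lpsubst (- 'X - 'X%:P) lpconst (lbr b a);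
  (* [a_lambda [b_mu c]] =
       [[a_lambda b]_(lambda + mu) c] + [b_mu [a_lambda c]] *)
  lbr_jacobi : forall a b c,
    lpsubst mu2 (fun x => at2 lam2 (lbr a x)) (lbr b c) =
    lpsubst lam2 (fun x => at2 (lam2 + mu2) (lbr x c)) (lbr a b) +
    lpsubst lam2 (fun x => at2 mu2 (lbr b x)) (lbr a c)
}.

#[short(type="lieConformalType")]
HB.structure Definition LieConformal (C : fieldType) :=
  {V of GRing.Lmodule {poly C} V & Lmodule_isLieConformal C V}.

Section Derivations.
Variables (C : fieldType) (V : lieConformalType C).
Implicit Types (D : V -> lpoly V) (a b : V).

Local Open Scope classical_set_scope.

(* gc(V) *)
Definition Cend : set (V -> lpoly V) := [set D |
  [/\ forall a b, D (a + b) = D a + D b,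
      forall (c : C) a, D (c%:P *: a) = c%:P%:P *: D a &
      forall a, D ('X *: a) = ('X%:P + 'X) *: D a]].

(* D_lambda([a_mu b]) *)
Definition Dbr D a b : lpoly (lpoly V) :=
  lpsubst mu2 (fun x => at2 lam2 (D x)) (lbr a b).

(* [(D_lambda a)_(lambda + mu) b] *)
Definition brDl D a b : lpoly (lpoly V) :=
  lpsubst lam2 (fun x => at2 (lam2 + mu2) (lbr x b)) (D a).

(* [a_mu (D_lambda b)] *)
Definition brDr D a b : lpoly (lpoly V) :=
  lpsubst lam2 (fun x => at2 mu2 (lbr a x)) (D b).

Definition CDer : set (V -> lpoly V) := [set D | Cend D /\
  forall a b, Dbr D a b = brDl D a b + brDr D a b].

Definition QDer : set (V -> lpoly V) := [set D | Cend D /\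
  exists2 D', Cend D' & forall a b, brDl D a b + brDr D a b = Dbr D' a b].

Definition GDer : set (V -> lpoly V) := [set D | Cend D /\
  exists D' D'', [/\ Cend D', Cend D'' &
    forall a b, brDl D a b + brDr D' a b = Dbr D'' a b]].

Definition Centroid : set (V -> lpoly V) := [set D | Cend D /\
  forall a b, Dbr D a b = brDl D a b /\ brDl D a b = brDr D a b].

Definition QCentroid : set (V -> lpoly V) := [set D | Cend D /\
  forall a b, brDl D a b = brDr D a b].

End Derivations.

Arguments Cend {C} V.
Arguments CDer {C} V.
Arguments QDer {C} V.
Arguments GDer {C} V.
Arguments Centroid {C} V.
Arguments QCentroid {C} V.

Definition addset (M : zmodType) (T : Type) (S1 S2 : set (T -> M)) :
    set (T -> M) :=
  [set (D1 \+ D2) | D1 in S1 & D2 in S2]%classic.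

(* Main.v *)
Require Import Defs.
From mathcomp Require Import all_boot all_order all_algebra.
From mathcomp Require Import finmap monalg.
From mathcomp Require Import boolp classical_sets reals complex.

(** The heart of the matter is a symmetry of the defining identity of GDer:
    if [(D_lambda a)_(lambda + mu) b] + [a_mu (D'_lambda b)] equals
    D''_lambda([a_mu b]) for all a and b, then the same holds with D and D'
    exchanged.  To see this, write the identity for the pair (b, a), substitute
    mu := - lambda - mu - d in it, and apply skew-symmetry.  Since
    skew-symmetry at an arbitrary scalar s reads
    [a_s b] = - [b_(- s - d) a], and since D''_lambda moves d to d + lambda,
    the substitution exchanges the three terms up to one common sign:
    [(D_lambda b)_(lambda + mu) a] becomes - [a_mu (D_lambda b)],
    [b_mu (D_lambda a)] becomes - [(D_lambda a)_(lambda + mu) b], and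
    D''_lambda([b_mu a]) becomes - D''_lambda([a_mu b]); these are [flip_brDl],
    [flip_brDr] and [flip_Dbr].

    Adding and subtracting the two identities shows that (D + D') / 2 is a
    quasiderivation, with the same D'', and that (D - D') / 2 is in the
    quasicentroid; their sum is D.  Conversely, if D1 is a quasiderivation with
    witness D1' and D2 is in the quasicentroid, then D1 + D2 is a generalized
    derivation with witnesses D1 - D2 and D1'.  As for the centroid, adding the
    two defining equations shows that each D in C(R) is a quasiderivation with
    witness D + D, and quasiderivations, among which are the derivations, are
    closed under addition.

    Substitutions are handled without naming the underlying morphisms of
    polynomial rings: it is enough to know, for an additive map f and a few
    scalars p, a scalar q such that f (p u) = q f(u) ([intertwines]); such pairs
    (p, q) form a ring. *)

Set Implicit Arguments.
Unset Strict Implicit.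
Unset Printing Implicit Defensive.

Import GRing.Theory.
Local Open Scope ring_scope.

(** * Additive maps and the scalars they intertwine *)

Definition intertwines (A B : pzRingType) (V : lmodType A) (W : lmodType B)
  (f : V -> W) (p : A) (q : B) := forall u, f (p *: u) = q *: f u.

Section Additive.
Variables (U V : zmodType) (f : U -> V).
Hypothesis fD : {morph f : x y / x + y}.

Lemma additive0 : f 0 = 0.
Proof. by apply: (addrI (f 0)); rewrite -fD !addr0. Qed.

Lemma additiveN x : f (- x) = - f x.
Proof. by apply: (addrI (f x)); rewrite -fD !subrr additive0. Qed.

Lemma additiveB x y : f (x - y) = f x - f y.
Proof. by rewrite fD additiveN. Qed.

Lemma additive_sum (I : Type) (r : seq I) (F : I -> U) :
  f (\sum_(i <- r) F i) = \sum_(i <- r) f (F i).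
Proof. exact: (big_morph f fD additive0). Qed.

End Additive.

Section Intertwines.
Variables (A B : pzRingType) (V : lmodType A) (W : lmodType B) (f : V -> W).
Hypothesis fD : {morph f : x y / x + y}.

Lemma intertwinesD p p' q q' : intertwines f p q -> intertwines f p' q' ->
  intertwines f (p + p') (q + q').
Proof. by move=> fp fp' u; rewrite !scalerDl fD fp fp'. Qed.

Lemma intertwinesN p q : intertwines f p q -> intertwines f (- p) (- q).
Proof. by move=> fp u; rewrite !scaleNr (additiveN fD) fp. Qed.

Lemma intertwinesX p q n :
  intertwines f p q -> intertwines f (p ^+ n) (q ^+ n).
Proof.
move=> fp; elim: n => [|n IHn] u; first by rewrite !expr0 !scale1r.
by rewrite !exprS -!scalerA fp IHn.
Qed.

End Intertwines.

(** * Substitution in polynomials with coefficients in a module *)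

Section Polynomials.
Variables (A : comNzRingType) (V : lmodType A).
Implicit Types (u v : lpoly V) (x y : V).

Lemma lpmonomD n : {morph @lpmonom A V n : x y / x + y}.
Proof.
move=> x y; apply/lpolyP => k; rewrite lpcoefD !lpcoef_monom.
by case: eqP => // _; rewrite addr0.
Qed.

Lemma lpconstD : {morph @lpconst A V : x y / x + y}.
Proof. exact: lpmonomD. Qed.

Lemma lpoly_sum_monom u : u = \sum_(n <- msupp u) lpmonom n (lpcoef u n).
Proof. exact: monalgE. Qed.

Lemma scaleX_monom n x : 'X *: lpmonom n x = lpmonom n.+1 x.
Proof.
apply/lpolyP => k; rewrite (lpcoef_scale 'X) lpcoef_monom.
case: k => [|k].
  by rewrite big_ord_recl big_ord0 coefX scale0r addr0.
rewrite big_ord_recl big_ord_recl big1 => [|i _]; last by rewrite coefX scale0r.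
by rewrite !coefX scale0r add0r scale1r addr0 lpcoef_monom subn1 eqSS.
Qed.

Lemma scaleC_monom (p : A) n x : p%:P *: lpmonom n x = lpmonom n (p *: x).
Proof.
apply/lpolyP => k; rewrite (lpcoef_scale p%:P) lpcoef_monom.
rewrite big_ord_recl big1 => [|i _]; last by rewrite coefC scale0r.
rewrite coefC eqxx addr0 subn0 lpcoef_monom.
by case: eqP => // _; rewrite scaler0.
Qed.

Lemma intertwines_lpconst (p : A) : intertwines (@lpconst A V) p p%:P.
Proof. by move=> x; rewrite /lpconst scaleC_monom. Qed.

Lemma eq_on_monom (W : zmodType) (g h : lpoly V -> W) :
    {morph g : u v / u + v} -> {morph h : u v / u + v} ->
    (forall n x, g (lpmonom n x) = h (lpmonom n x)) -> g =1 h.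
Proof.
move=> gD hD gh u; rewrite (lpoly_sum_monom u).
by rewrite (additive_sum gD) (additive_sum hD); apply: eq_bigr.
Qed.

End Polynomials.

Section Substitution.
Variables (A B : comNzRingType) (V : lmodType A) (W : lmodType B).
Implicit Types (f g : V -> W) (s t : B) (u v : lpoly V).

Lemma eq_lpsubst s f g u : f =1 g -> lpsubst s f u = lpsubst s g u.
Proof. by move=> fg; apply: eq_bigr => n _; rewrite fg. Qed.

Lemma lpsubst_addf s f g u :
  lpsubst s (fun x => f x + g x) u = lpsubst s f u + lpsubst s g u.
Proof.
by rewrite /lpsubst -big_split; apply: eq_bigr => n _; rewrite /= scalerDr.
Qed.

Lemma lpsubst_scalef s f t u :
  lpsubst s (fun x => t *: f x) u = t *: lpsubst s f u.
Proof.
rewrite /lpsubst scaler_sumr; apply: eq_bigr => n _.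
by rewrite !scalerA mulrC.
Qed.

Lemma lpsubst_oppf s f u : lpsubst s (fun x => - f x) u = - lpsubst s f u.
Proof.
by rewrite -scaleN1r -lpsubst_scalef; apply: eq_lpsubst => x; rewrite scaleN1r.
Qed.

(** This is how a change of variables acts on a substituted polynomial: the
    scalar s is replaced by its image t, and the rest happens on coefficients. *)
Lemma lpsubst_comp (B' : comNzRingType) (W' : lmodType B') (h : W -> W')
    s (t : B') f u :
  {morph h : x y / x + y} -> intertwines h s t ->
  h (lpsubst s f u) = lpsubst t (fun x => h (f x)) u.
Proof.
move=> hD hs; rewrite (additive_sum hD); apply: eq_bigr => n _.
exact: intertwinesX.
Qed.

End Substitution.

Section AdditiveSubstitution.
Variables (A B : comNzRingType) (V : lmodType A) (W : lmodType B).
Variables (s : B) (f : V -> W).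
Implicit Types (u v : lpoly V) (x : V).
Hypothesis fD : {morph f : x y / x + y}.

Lemma lpsubst_widen (d : {fset nat}) u : (msupp u `<=` d)%fset ->
  lpsubst s f u = \sum_(n <- d) s ^+ n *: f (lpcoef u n).
Proof.
move=> ud; apply: big_fset_incl => // n _ nu.
by rewrite /lpcoef (mcoeff_outdom nu) (additive0 fD) scaler0.
Qed.

Lemma lpsubstD : {morph lpsubst s f : u v / u + v}.
Proof.
move=> u v; pose d := (msupp u `|` msupp v `|` msupp (u + v)%R)%fset.
have ud : (msupp u `<=` d)%fset by rewrite /d -fsetUA fsubsetUl.
have vd : (msupp v `<=` d)%fset by rewrite /d fsetUAC fsubsetUr.
have uvd : (msupp (u + v)%R `<=` d)%fset by rewrite /d fsubsetUr.
rewrite (lpsubst_widen ud) (lpsubst_widen vd) (lpsubst_widen uvd) -big_split.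
by apply: eq_bigr => n _ /=; rewrite lpcoefD fD scalerDr.
Qed.

Lemma lpsubst_monom n x : lpsubst s f (lpmonom n x) = s ^+ n *: f x.
Proof.
rewrite (@lpsubst_widen [fset n]%fset); last exact: msuppU_le.
by rewrite big_seq_fset1 lpcoef_monom eqxx.
Qed.

Lemma lpsubst_const x : lpsubst s f (lpconst x) = f x.
Proof. by rewrite lpsubst_monom expr0 scale1r. Qed.

Lemma intertwines_lpsubstX : intertwines (lpsubst s f) 'X s.
Proof.
apply: eq_on_monom => [u v|u v|n x]; rewrite ?scalerDr ?lpsubstD ?scalerDr //.
by rewrite scaleX_monom !lpsubst_monom scalerA exprS.
Qed.

Lemma intertwines_lpsubstC p q :
  intertwines f p q -> intertwines (lpsubst s f) p%:P q.
Proof.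
move=> fp; apply: eq_on_monom => [u v|u v|n x];
  rewrite ?scalerDr ?lpsubstD ?scalerDr //.
by rewrite scaleC_monom !lpsubst_monom fp !scalerA mulrC.
Qed.

(** If f moves p to q, substituting - x - p for the indeterminate x before
    substituting s is the same as substituting - s - q.  With p the derivation
    this is the reparametrisation that occurs in skew-symmetry. *)
Lemma lpsubst_reflect p q u : intertwines f p q ->
  lpsubst s f (lpsubst (- 'X - p%:P) lpconst u) = lpsubst (- s - q) f u.
Proof.
move=> fp; have gD : {morph lpsubst s f : u v / u + v} by exact: lpsubstD.
have gs : intertwines (lpsubst s f) (- 'X - p%:P) (- s - q).
  apply: (intertwinesD gD); apply: (intertwinesN gD).
    exact: intertwines_lpsubstX.
  exact: intertwines_lpsubstC.
rewrite (lpsubst_comp _ _ gD gs).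
by apply: eq_lpsubst => x; rewrite lpsubst_const.
Qed.

End AdditiveSubstitution.

(** * Two indeterminates and the substitution mu := - lambda - mu - d *)

Section TwoIndeterminates.
Variables (C : fieldType) (V : lmodType {poly C}).
Implicit Types (s : {poly {poly {poly C}}}) (u : lpoly V).

Definition del2 : {poly {poly {poly C}}} := 'X%:P%:P.

Let const2 (x : V) : lpoly (lpoly V) := lpconst (lpconst x).

Let const2D : {morph const2 : x y / x + y}.
Proof. by move=> x y; rewrite /const2 !lpconstD. Qed.

Let intertwines_const2 (p : {poly C}) : intertwines const2 p p%:P%:P.
Proof. by move=> x; rewrite /const2 !intertwines_lpconst. Qed.

Lemma at2D s : {morph @at2 C V s : u v / u + v}.
Proof. exact/lpsubstD/const2D. Qed.

Lemma intertwines_at2X s : intertwines (@at2 C V s) 'X s.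
Proof. exact/intertwines_lpsubstX/const2D. Qed.

Lemma intertwines_at2C s (p : {poly C}) :
  intertwines (@at2 C V s) p%:P p%:P%:P.
Proof. exact: intertwines_lpsubstC const2D _ _ (intertwines_const2 p). Qed.

Lemma at2_reflect s u :
  at2 s (lpsubst (- 'X - 'X%:P) lpconst u) = at2 (- s - del2) u.
Proof. exact: (lpsubst_reflect s const2D u (intertwines_const2 'X)). Qed.

(** The substitution mu := - lambda - mu - d in V[mu][lambda].  Combined with
    skew-symmetry, it exchanges brackets with parameter mu and brackets with
    parameter lambda + mu. *)
Definition flip_mu : lpoly (lpoly V) -> lpoly (lpoly V) :=
  lpsubst lam2 (at2 (- lam2 - mu2 - del2)).

Lemma flip_muD : {morph flip_mu : w w' / w + w'}.
Proof. exact/lpsubstD/at2D. Qed.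

Lemma intertwines_flip_lam : intertwines flip_mu lam2 lam2.
Proof. exact/intertwines_lpsubstX/at2D. Qed.

Lemma intertwines_flip_mu : intertwines flip_mu mu2 (- lam2 - mu2 - del2).
Proof. by apply/intertwines_lpsubstC/intertwines_at2X/at2D. Qed.

Lemma intertwines_flip_lam_mu :
  intertwines flip_mu (lam2 + mu2) (- mu2 - del2).
Proof.
have E (M : zmodType) (l m d : M) : l + (- l - m - d) = - m - d.
  by rewrite -[- l - m - d]addrA addNKr.
rewrite -(E _ lam2 mu2); apply: (intertwinesD flip_muD).
  exact: intertwines_flip_lam.
exact: intertwines_flip_mu.
Qed.

Lemma flip_at2 s s' u :
  intertwines flip_mu s s' -> flip_mu (at2 s u) = at2 s' u.
Proof.
move=> ss'; rewrite /at2 (lpsubst_comp _ _ flip_muD ss').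
apply: eq_lpsubst => x; rewrite /flip_mu lpsubst_const; last exact: at2D.
by rewrite /at2 (lpsubst_const _ const2D).
Qed.

End TwoIndeterminates.

Arguments del2 {C}.

(** * Combining two identities *)

(** The linear algebra of the proof, with the terms of the derivation
    identities replaced by elements of an arbitrary module.  In
    [half_sum_identities] and [sub_identities], x and z stand for the terms
    [(D_lambda a)_(lambda + mu) b] of two maps D and D', and y and t for their
    terms [a_mu (D_lambda b)], so that x + t and z + y are the left-hand sides
    of the identity for (D, D') and of the exchanged one. *)
Section Combinations.
Variables (A : comNzRingType) (M : lmodType A).
Implicit Types (h : A) (x y z t w : M).

Lemma add_identities x y z t w w' :
  x + y = w -> z + t = w' -> x + z + (y + t) = w + w'.
Proof. by move=> <- <-; rewrite addrACA. Qed.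

Lemma cancel_identity x y z w t : x + y = w -> z = t ->
  x + z + (y - t) = w.
Proof. by move=> <- ->; rewrite addrACA subrr addr0. Qed.

(** A change of variables f that swaps the kinds of the two terms, with a sign,
    carries an identity to the exchanged one. *)
Lemma exchange_identity (f : M -> M) x y z x' y' z' :
  {morph f : u v / u + v} -> f x = - y' -> f y = - x' -> f z = - z' ->
  x + y = z -> x' + y' = z'.
Proof.
move=> fD fx fy fz xyz; apply: oppr_inj.
by rewrite -fz -xyz fD fx fy opprD addrC.
Qed.

Lemma half_sum_identities h x y z t w : h + h = 1 ->
  x + t = w -> z + y = w -> h *: (x + z) + h *: (y + t) = w.
Proof.
move=> h2 xt zy.
by rewrite -scalerDr (addrC y) addrACA xt zy scalerDr -scalerDl h2 scale1r.
Qed.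

Lemma sub_identities h x y z t w : x + t = w -> z + y = w ->
  h *: (x - z) = h *: (y - t).
Proof.
move=> <- E; congr (_ *: _); apply/eqP.
by rewrite subr_eq addrAC eq_sym subr_eq addrC E.
Qed.

Lemma half_sum_diff h x y : h + h = 1 ->
  h *: (x + y) + h *: (x - y) = x.
Proof.
by move=> h2; rewrite -scalerDr addrACA subrr addr0
  scalerDr -scalerDl h2 scale1r.
Qed.

End Combinations.

(** * The three terms of the derivation identities *)

Section Terms.
Variables (C : fieldType) (V : lieConformalType C).
Implicit Types (D : V -> lpoly V) (a b x : V) (s : {poly {poly {poly C}}}).

Lemma at2_lbrDl s b : {morph (fun x : V => at2 s (lbr x b)) : x y / x + y}.
Proof. by move=> x y; rewrite lbrDl at2D. Qed.

Lemma at2_lbrDr s a : {morph (fun x : V => at2 s (lbr a x)) : x y / x + y}.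
Proof. by move=> x y; rewrite lbrDr at2D. Qed.

Lemma at2_CendD s D : Cend V D -> {morph (fun x => at2 s (D x)) : x y / x + y}.
Proof. by case=> DD _ _ x y; rewrite DD at2D. Qed.

(** Skew-symmetry relates the parameters lambda and - lambda - d; substituting
    s for lambda gives it at any scalar s, since d acts through the
    coefficients. *)
Lemma at2_skew s a b : at2 s (lbr a b) = - at2 (- s - del2) (lbr b a).
Proof. by rewrite lbr_skew (additiveN (@at2D _ _ s)) at2_reflect. Qed.

Lemma at2_skewD s s' a b :
  at2 (s + s') (lbr a b) = - at2 (- s - s' - del2) (lbr b a).
Proof. by rewrite at2_skew opprD. Qed.

(** Under the flip the parameter lambda + mu becomes - mu - d, which
    skew-symmetry turns into mu. *)
Lemma flip_brDl D a b : flip_mu (brDl D b a) = - brDr D a b.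
Proof.
rewrite /brDl (lpsubst_comp _ _ (@flip_muD C V) (@intertwines_flip_lam C V)).
rewrite -lpsubst_oppf; apply: eq_lpsubst => x.
rewrite (flip_at2 _ (@intertwines_flip_lam_mu C V)).
exact/(canRL (@opprK _))/esym/at2_skew.
Qed.

(** Under the flip the parameter mu becomes - (lambda + mu) - d, which
    skew-symmetry turns into lambda + mu. *)
Lemma flip_brDr D a b : flip_mu (brDr D b a) = - brDl D a b.
Proof.
rewrite /brDr (lpsubst_comp _ _ (@flip_muD C V) (@intertwines_flip_lam C V)).
rewrite -lpsubst_oppf; apply: eq_lpsubst => x.
apply: (etrans (flip_at2 _ (@intertwines_flip_mu C V))).
exact/(canRL (@opprK _))/esym/at2_skewD.
Qed.

(** On the left, mu becomes - lambda - mu - d by the flip.  On the right,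
    skew-symmetry inside D_lambda puts - mu - d in place of mu, and D_lambda
    moves this d to d + lambda, so the same scalar appears. *)
Lemma flip_Dbr D a b : Cend V D -> flip_mu (Dbr D b a) = - Dbr D a b.
Proof.
move=> cD; have fD := at2_CendD lam2 cD.
have f_del : intertwines (fun x => at2 lam2 (D x)) 'X (del2 + lam2).
  move=> x; case: cD => _ _ ->; apply: (intertwinesD (@at2D C V _)).
    exact: intertwines_at2C.
  exact: intertwines_at2X.
rewrite /Dbr (lpsubst_comp _ _ (@flip_muD C V) (@intertwines_flip_mu C V)).
rewrite (lbr_skew a b) (additiveN (lpsubstD mu2 fD)) opprK.
rewrite (lpsubst_reflect mu2 fD _ f_del).
have flip_D x : flip_mu (at2 lam2 (D x)) = at2 lam2 (D x).
  exact/flip_at2/intertwines_flip_lam.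
apply: (etrans (eq_lpsubst _ _ flip_D)).
have E (M : zmodType) (l m d : M) : - l - m - d = - m - (d + l).
  by rewrite opprD (addrC (- d)) addrA (addrC (- m)).
by congr (lpsubst _ _ _); apply: E.
Qed.

Definition scale_map (c : C) D : V -> lpoly V := fun a => c%:P%:P *: D a.

Lemma brDl_add D1 D2 a b : brDl (D1 \+ D2) a b = brDl D1 a b + brDl D2 a b.
Proof. exact/lpsubstD/at2_lbrDl. Qed.

Lemma brDr_add D1 D2 a b : brDr (D1 \+ D2) a b = brDr D1 a b + brDr D2 a b.
Proof. exact/lpsubstD/at2_lbrDr. Qed.

Lemma brDl_sub D1 D2 a b : brDl (D1 \- D2) a b = brDl D1 a b - brDl D2 a b.
Proof. exact/additiveB/lpsubstD/at2_lbrDl. Qed.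

Lemma brDr_sub D1 D2 a b : brDr (D1 \- D2) a b = brDr D1 a b - brDr D2 a b.
Proof. exact/additiveB/lpsubstD/at2_lbrDr. Qed.

Lemma Dbr_add D1 D2 a b : Dbr (D1 \+ D2) a b = Dbr D1 a b + Dbr D2 a b.
Proof.
by rewrite /Dbr -lpsubst_addf; apply: eq_lpsubst => x; rewrite /= at2D.
Qed.

Lemma brDl_scale c D a b : brDl (scale_map c D) a b = c%:P%:P%:P *: brDl D a b.
Proof.
apply: (intertwines_lpsubstC _ (@at2_lbrDl _ b)) => x.
by rewrite lbrZl; apply: intertwines_at2C.
Qed.

Lemma brDr_scale c D a b : brDr (scale_map c D) a b = c%:P%:P%:P *: brDr D a b.
Proof.
apply: (intertwines_lpsubstC _ (@at2_lbrDr _ a)) => x.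
by rewrite lbrZr; apply: intertwines_at2C.
Qed.

(** * Sums, differences and multiples of conformal linear maps *)

Lemma Cend_add D1 D2 : Cend V D1 -> Cend V D2 -> Cend V (D1 \+ D2).
Proof.
move=> [D1D D1Z D1d] [D2D D2Z D2d]; split=> [a b|c a|a] /=.
- by rewrite D1D D2D addrACA.
- by rewrite D1Z D2Z scalerDr.
- by rewrite D1d D2d scalerDr.
Qed.

Lemma Cend_sub D1 D2 : Cend V D1 -> Cend V D2 -> Cend V (D1 \- D2).
Proof.
move=> [D1D D1Z D1d] [D2D D2Z D2d]; split=> [a b|c a|a] /=.
- by rewrite D1D D2D opprD addrACA.
- by rewrite D1Z D2Z scalerBr.
- by rewrite D1d D2d scalerBr.
Qed.

Lemma Cend_scale c D : Cend V D -> Cend V (scale_map c D).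
Proof.
rewrite /scale_map => -[DD DZ Dd]; split=> [a b|c' a|a].
- by rewrite DD scalerDr.
- by rewrite DZ !scalerA mulrC.
- by rewrite Dd !scalerA mulrC.
Qed.

(** * The inclusions between spaces of generalized derivations *)

Local Open Scope classical_set_scope.

Lemma Centroid_subset_QDer : Centroid V `<=` QDer V.
Proof.
move=> D [cD DC]; split=> //; exists (D \+ D); first exact: Cend_add.
by move=> a b; have [E1 E2] := DC a b; rewrite Dbr_add -E2 -E1.
Qed.

Lemma Centroid_subset_QCentroid : Centroid V `<=` QCentroid V.
Proof.
by move=> D [cD DC]; split=> [|a b]; [exact: cD | exact: (DC a b).2].
Qed.

Lemma CDer_subset_QDer : CDer V `<=` QDer V.
Proof.
move=> D [cD DE]; split; first exact: cD.
by exists D; [exact: cD | move=> a b; rewrite DE].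
Qed.

Lemma QDer_add D1 D2 : QDer V D1 -> QDer V D2 -> QDer V (D1 \+ D2).
Proof.
move=> [cD1 [D1' cD1' D1E]] [cD2 [D2' cD2' D2E]]; split; first exact: Cend_add.
exists (D1' \+ D2'); first exact: Cend_add.
move=> a b; rewrite brDl_add brDr_add (Dbr_add D1' D2').
exact: add_identities (D1E a b) (D2E a b).
Qed.

(** The exchanged identity for (a, b) is, up to sign, the flip of the original
    identity for (b, a). *)
Lemma GDer_identity_sym D D' D'' : Cend V D'' ->
  (forall a b, brDl D a b + brDr D' a b = Dbr D'' a b) ->
  forall a b, brDl D' a b + brDr D a b = Dbr D'' a b.
Proof.
move=> cD'' DE a b.
exact: (exchange_identity (@flip_muD C V) (flip_brDl _ _ _)
  (flip_brDr _ _ _) (flip_Dbr _ _ cD'') (DE b a)).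
Qed.

Lemma QDer_add_QCentroid_subset_GDer :
  addset (QDer V) (QCentroid V) `<=` GDer V.
Proof.
move=> _ [D1 [cD1 [D1' cD1' D1E]] [D2 [cD2 D2E]] <-].
split; first exact: Cend_add.
exists (D1 \- D2), D1'; split=> [||a b].
- exact: Cend_sub.
- exact: cD1'.
- rewrite brDl_add (brDr_sub D1 D2).
  exact: cancel_identity (D1E a b) (D2E a b).
Qed.

Lemma GDer_subset_QDer_add_QCentroid :
  (2 : C) != 0 -> GDer V `<=` addset (QDer V) (QCentroid V).
Proof.
move=> two_neq0 D [cD [D' [D'' [cD' cD'' DE]]]].
have DE' := GDer_identity_sym cD'' DE.
have half (A : comNzRingType) (f : {rmorphism C -> A}) :
    f 2^-1 + f 2^-1 = 1.
  have -> : f 2^-1 + f 2^-1 = f (2^-1 * 2) by rewrite mulrDr mulr1 rmorphD.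
  by rewrite mulVf // rmorph1.
have half2 : (2^-1 : C)%:P%:P + (2^-1 : C)%:P%:P = 1.
  exact: (half _ (polyC \o polyC)).
have half3 : (2^-1 : C)%:P%:P%:P + (2^-1 : C)%:P%:P%:P = 1.
  exact: (half _ (polyC \o (polyC \o polyC))).
exists (scale_map 2^-1 (D \+ D')).
  split; first by apply/Cend_scale/Cend_add.
  exists D'' => [|a b]; first exact: cD''.
  rewrite brDl_scale brDr_scale brDl_add brDr_add.
  exact: half_sum_identities half3 (DE a b) (DE' a b).
exists (scale_map 2^-1 (D \- D')).
  split; first by apply/Cend_scale/Cend_sub.
  move=> a b; rewrite brDl_scale brDr_scale (brDl_sub D D') (brDr_sub D D').
  exact: sub_identities (DE a b) (DE' a b).
by apply/funext => a; exact: half_sum_diff half2.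
Qed.

End Terms.

Local Open Scope classical_set_scope.

Theorem lemma3p7 (K : realType) (R : lieConformalType K[i]%C) :
  [/\ addset (Centroid R) (CDer R) `<=` QDer R,
      Centroid R `<=` QDer R `&` QCentroid R
    & GDer R = addset (QDer R) (QCentroid R)].
Proof.
split.
- move=> _ [D1 D1C [D2 D2C <-]]; apply: QDer_add.
    exact: Centroid_subset_QDer.
  exact: CDer_subset_QDer.
- move=> D DC; split.
    exact: Centroid_subset_QDer.
  exact: Centroid_subset_QCentroid.
- apply/seteqP; split; last exact: QDer_add_QCentroid_subset_GDer.
  apply: GDer_subset_QDer_add_QCentroid.
  by rewrite Num.Theory.pnatr_eq0.
Qed.
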